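(* Let $(A^+,\mathfrak{p})$ be a semi-valuation ring with non-trivial valuation. Then every finitely 2-presented $A^+$-module has projective dimension $\leq 1$. In particular, the ring $A^+$ is 2-regular.
   Context: All rings are commutative with unit. A valuation on a ring $R$ is a map $|-|\colon R\to\Gamma\cup\{0\}$, with $\Gamma$ a totally ordered multiplicative abelian group, such that $|0|=0$, $|1|=1$, $|xy|=|x||y|$, $|x+y|\le\max\{|x|,|y|\}$ (conventions $0\cdot\gamma=0$, $0<\gamma$ for $\gamma\in\Gamma$); its support is the prime ideal $|-|^{-1}(0)$. A semi-valuation ring is a ring $A^+$ with a valuation $|-|$ such that (1) every zero divisor of $A^+$ lies in the support of $|-|$ and (2) for all $x,y\in A^+$ with $|x|\le|y|\ne 0$ one has $y\mid x$ in $A^+$. One writes it as $(A^+,\mathfrak{p})$ where $\mathfrak{p}$ is the support of $|-|$; then $A^+$ is local and $V=A^+/\mathfrak{p}$ is a valuation ring. The valuation is called non-trivial if $V$ is not a field. For $n\in\mathbf{N}$, a module $M$ over a ring $R$ is finitely $n$-presented if there is an exact sequence $F_n\to\cdots\to F_1\to F_0\to M\to0$ with all $F_i$ finitely generated free. The ring $R$ is $n$-regular if every finitely $n$-presented $R$-module has finite projective dimension. *)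

(* Defs.v *)
From HB Require Import structures.
From mathcomp Require Import all_boot all_order all_algebra.

Set Implicit Arguments.
Unset Strict Implicit.
Unset Printing Implicit Defensive.

Import Order.TTheory GRing.Theory.

HB.mixin Record isOrderedAbGroup (d : Order.disp_t) G
    of Group G & Order.Total d G := {
  oag_mulC : forall x y : G, (x * y = y * x)%g;
  oag_leM2l : forall z x y : G, (x <= y)%O -> (z * x <= z * y)%O%g
}.

#[short(type="orderedAbGroupType")]
HB.structure Definition OrderedAbGroup (d : Order.disp_t) :=
  { G of isOrderedAbGroup d G & Group G & Order.Total d G }.

(* Gamma u {0} is [option G], with [None] for 0. *)

Section WithZero.
Variables (d : Order.disp_t) (G : orderedAbGroupType d).

Definition vmul (a b : option G) : option G :=
  match a, b with
  | Some x, Some y => Some (x * y)%g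
  | _, _ => None
  end.

Definition vle (a b : option G) : bool :=
  match a, b with
  | None, _ => true
  | Some x, Some y => (x <= y)%O
  | Some _, None => false
  end.

Definition vmax (a b : option G) : option G := if vle a b then b else a.

End WithZero.

Local Open Scope ring_scope.

Record valuation (A : comNzRingType) (d : Order.disp_t)
    (G : orderedAbGroupType d) := Valuation {
  val_fun :> A -> option G;
  valu0 : val_fun 0 = None;
  valu1 : val_fun 1 = Some 1%g;
  valuM : forall x y, val_fun (x * y) = vmul (val_fun x) (val_fun y);
  valuD : forall x y, vle (val_fun (x + y)) (vmax (val_fun x) (val_fun y))
}.

Section Support.
Variables (A : comNzRingType) (d : Order.disp_t) (G : orderedAbGroupType d).
Variable v : valuation A G.

Definition val_support : {pred A} := [pred x | v x == None].

Lemma support_idealr_closed : idealr_closed val_support.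
Proof.
split; rewrite ?unfold_in /val_support ?valu0 ?valu1 //.
move=> a x y; rewrite !unfold_in => /eqP vx /eqP vy.
have := valuD v (a * x) y.
by rewrite valuM vx vy; case: (v a) => [?|] /=; case: (v _).
Qed.

Lemma support_prime : prime_idealr_closed val_support.
Proof.
move=> x y; rewrite !unfold_in /val_support valuM.
by case: (v x) => [?|] //; case: (v y).
Qed.

HB.instance Definition _ := isIdealr.Build A val_support support_idealr_closed.
HB.instance Definition _ := isPrimeIdealrClosed.Build A val_support support_prime.

(* A / p, for p the support of v *)
Definition residue_ring : comNzRingType := {ideal_quot val_support}.

End Support.

Definition zero_divisor (A : comNzRingType) (x : A) : Prop :=
  exists2 y : A, y != 0 & x * y = 0.

(* 1 != 0 is part of the structure [comNzRingType]. *)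
Definition is_field (K : comNzRingType) : Prop :=
  forall x : K, x != 0 -> exists y : K, x * y = 1.

Section SemiValuation.
Variables (A : comNzRingType) (d : Order.disp_t) (G : orderedAbGroupType d).

Record semi_valuation_ring (v : valuation A G) : Prop := SemiValuationRing {
  svr_zero_divisor : forall x : A, zero_divisor x -> x \in val_support v;
  svr_dvd : forall x y : A,
    vle (v x) (v y) -> v y <> None -> exists z : A, x = y * z
}.

Definition nontrivial_valuation (v : valuation A G) : Prop :=
  ~ is_field (residue_ring v).

End SemiValuation.

Section Modules.
Variable R : comNzRingType.

Definition surjective (U V : lmodType R) (f : {linear U -> V}) : Prop :=
  forall y : V, exists x : U, f x = y.

Definition exact_at (U V W : lmodType R)
    (f : {linear U -> V}) (g : {linear V -> W}) : Prop :=
  forall y : V, g y = 0 <-> exists x : U, f x = y.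

Definition fg_free (F : lmodType R) : Prop :=
  exists (n : nat) (f : {linear 'rV[R]_n -> F}), bijective f.

Definition projective (P : lmodType R) : Prop :=
  forall (M N : lmodType R) (g : {linear M -> N}) (f : {linear P -> N}),
    surjective g -> exists h : {linear P -> M}, forall x : P, g (h x) = f x.

(* Exactness of F_n -> ... -> F_1 -> F_0 -> M -> 0 at M, F_0, ..., F_(n-1);
   the terms F_i with i > n are not constrained. *)
Definition exact_upto (n : nat) (M : lmodType R) (F : nat -> lmodType R)
    (d : forall i, {linear F i.+1 -> F i}) (e : {linear F 0%N -> M}) : Prop :=
  [/\ surjective e,
      (0 < n)%N -> exact_at (d 0%N) e
    & forall i, (i.+1 < n)%N -> exact_at (d i.+1) (d i)].

Definition finitely_presented (n : nat) (M : lmodType R) : Prop :=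
  exists (F : nat -> lmodType R) (d : forall i, {linear F i.+1 -> F i})
         (e : {linear F 0%N -> M}),
    (forall i, (i <= n)%N -> fg_free (F i)) /\ exact_upto n d e.

(* A projective resolution 0 -> P_n -> ... -> P_0 -> M -> 0, as an infinite
   one whose terms vanish beyond n; exactness at P_n, i.e. injectivity of
   P_n -> P_(n-1), comes from exactness of P_(n+1) = 0 -> P_n -> P_(n-1). *)
Definition proj_dim_le (n : nat) (M : lmodType R) : Prop :=
  exists (P : nat -> lmodType R) (d : forall i, {linear P i.+1 -> P i})
         (e : {linear P 0%N -> M}),
    [/\ forall i, projective (P i),
        forall i, (n < i)%N -> forall x : P i, x = 0
      & forall m, exact_upto m d e].

Definition finite_proj_dim (M : lmodType R) : Prop :=
  exists n : nat, proj_dim_le n M.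

End Modules.

Definition n_regular (n : nat) (R : comNzRingType) : Prop :=
  forall M : lmodType R, finitely_presented n M -> finite_proj_dim M.

(* Main.v *)
From HB Require Import structures.
Require Import Defs.
From mathcomp Require Import all_boot all_order all_algebra.

(** Let [p] be the support of [v] and [F_2 -> F_1 -> F_0 -> M -> 0] a
presentation.  The point is that the syzygy [K], the image of [F_1 -> F_0], is
not just projective but free, so that [0 -> K -> F_0 -> M -> 0] is a resolution
of length 1.  Two facts about [K] are used: it has finitely many generators
with finitely many relations, and it lies in a free module, so that elements
outside [p], which are not zero divisors, act injectively on it.

The proof is by induction on the number of generators
([fp_torsionfree_free]).

- If some relation has a coefficient outside [p], then its coefficient of
  largest value divides all the others.  This coefficient acts injectively on
  [K], so it can be cancelled from the relation, which then expresses one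
  generator in terms of the others ([row_primitive_part],
  [eliminate_generator]).

- Otherwise all relations have coefficients in [p]; let [B] be the matrix whose
  rows generate them.  Every [t] outside [p] divides every element of [p], so
  each row of [B] is [t] times a vector, and this vector is again a relation
  since [t] acts injectively on [K].  Hence [B = t C B] for some matrix [C], and
  the determinant trick gives [(1 - t c) B = 0] for some [c].  If [B] were
  nonzero, [1 - t c] would be a zero divisor and so lie in [p]; then every [t]
  outside [p] would be invertible modulo [p], against the nontriviality of the
  valuation.  So [B = 0] and the generators are a basis of [K]
  ([relations_in_support_eq0]). *)

Set Implicit Arguments.
Unset Strict Implicit.
Unset Printing Implicit Defensive.

Import Order.TTheory GRing.Theory.

(** * The order on values *)

Section ValueOrder.
Variables (d : Order.disp_t) (G : orderedAbGroupType d).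

Lemma vle_refl : reflexive (@vle d G).
Proof. by case=> [x|] //=. Qed.

Lemma vle_trans : transitive (@vle d G).
Proof. by case=> [y|] [x|] [z|] //=; exact: le_trans. Qed.

Lemma vle_total : total (@vle d G).
Proof. by case=> [x|] [y|] //=; exact: le_total. Qed.

End ValueOrder.

(** * Free modules and linear algebra over a commutative ring *)

Section FreeModules.
Local Open Scope ring_scope.
Variable R : comNzRingType.

Lemma linear_row_delta (n : nat) (U : lmodType R) (f : {linear 'rV[R]_n -> U})
    (x : 'rV[R]_n) : f x = \sum_i x 0 i *: f (delta_mx 0 i).
Proof.
rewrite {1}[x]row_sum_delta linear_sum.
by apply: eq_bigr => i _; rewrite linearZ.
Qed.

Lemma row_linear_map (n : nat) (U : lmodType R) (u : 'I_n -> U) :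
  exists f : {linear 'rV[R]_n -> U}, forall x, f x = \sum_i x 0 i *: u i.
Proof.
pose f (x : 'rV[R]_n) := \sum_i x 0 i *: u i.
have f_lin : linear f.
  move=> a x y; rewrite /f scaler_sumr -big_split /=; apply: eq_bigr => i _.
  by rewrite !mxE scalerDl scalerA.
pose fL := GRing.isLinear.Build R 'rV[R]_n U *:%R f f_lin.
pose F : {linear 'rV[R]_n -> U} := HB.pack f fL.
by exists F.
Qed.

Lemma fg_free_rV (n : nat) : fg_free 'rV[R]_n.
Proof. by exists n, idfun; exists id. Qed.

(** A lift is determined by lifts of the images of the finitely many basis
vectors, so finite choice is enough to produce it. *)
Lemma fg_free_projective (P : lmodType R) : fg_free P -> projective P.
Proof.
move=> [n [b [c bK cK]]] M N g f g_surj.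
have [m gm] := fin_all_exists (fun i => g_surj (f (b (delta_mx 0 i)))).
have [h hE] := row_linear_map m.
have [c' c'E] : exists c' : {linear P -> 'rV[R]_n}, forall x, c' x = c x.
  have c_lin : linear c.
    by move=> a x y; apply: (can_inj bK); rewrite linearP !cK.
  pose cL := GRing.isLinear.Build R P 'rV[R]_n *:%R c c_lin.
  by exists (HB.pack c cL : {linear P -> 'rV[R]_n}).
exists (h \o c') => x /=; rewrite c'E hE linear_sum -[x in RHS]cK.
rewrite -[RHS]/((f \o b) (c x)) linear_row_delta /=.
by apply: eq_bigr => i _; rewrite linearZ gm.
Qed.

Lemma fg_free_regular (F : lmodType R) (a : R) (u : F) :
  fg_free F -> (forall b, a * b = 0 -> b = 0) -> a *: u = 0 -> u = 0.
Proof.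
move=> [n [b [c bK cK]]] a_reg; rewrite -[u]cK -linearZ => au0.
suff -> : c u = 0 by rewrite linear0.
apply/rowP=> j; rewrite mxE; apply: a_reg.
have /rowP/(_ j) : a *: c u = 0 by apply: (can_inj bK); rewrite au0 linear0.
by rewrite !mxE.
Qed.

(** Modulo [t] the matrix is the identity.  To avoid the quotient by [t], [t] is
replaced by an indeterminate: the resulting polynomial takes the value 1 at 0,
so it is 1 plus a multiple of ['X]. *)
Lemma det_one_sub_scale (n : nat) (C : 'M[R]_n) (t : R) :
  exists c : R, \det (1%:M - t *: C) = 1 - t * c.
Proof.
pose p : {poly R} := \det (1%:M - 'X *: map_mx polyC C).
have pE a : p.[a] = \det (1%:M - a *: C).
  rewrite -[p.[a]]/(horner_eval a p) -det_map_mx; congr (\det _).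
  apply/matrixP=> i j.
  by rewrite !mxE rmorphB rmorphM rmorph_nat /= /horner_eval !hornerE.
have /factor_theorem[q pq] : root (p - 1) 0.
  by rewrite /root !hornerE pE scale0r subr0 det1 subrr.
exists (- q.[t]); rewrite -pE -[p](subrK 1) pq !hornerE /=.
by rewrite subr0 mulrN opprK mulrC addrC.
Qed.

(** The determinant trick behind Nakayama's lemma: [1 - t C] kills [B], hence so
does its determinant. *)
Lemma mul_det_one_sub (k n : nat) (C : 'M[R]_k) (t : R) (B : 'M[R]_(k, n)) :
  B = t *: (C *m B) -> exists c, (1 - t * c) *: B = 0.
Proof.
move=> BE; have [c detE] := det_one_sub_scale C t; exists c.
rewrite -detE -mul_scalar_mx -mul_adj_mx -mulmxA mulmxBl mul1mx -scalemxAl.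
by rewrite -BE subrr mulmx0.
Qed.

(** A relation [s] whose [i]-th coefficient is 1 writes the [i]-th generator in
terms of the others, so the same module is generated without it.  The new
relations are still generated by [k] vectors: they are what remains of the old
ones after clearing the [i]-th coordinate with [s]. *)
Lemma eliminate_generator (n k : nat) (U : lmodType R)
    (f : {linear 'rV[R]_n.+1 -> U}) (B : 'M[R]_(k, n.+1))
    (s : 'rV[R]_n.+1) (i : 'I_n.+1) :
    (forall x, f x = 0 <-> exists y, x = y *m B) -> f s = 0 -> s 0 i = 1 ->
  exists (f' : {linear 'rV[R]_n -> U}) (B' : 'M[R]_(k, n)),
    (forall x, f' x = 0 <-> exists y, x = y *m B')
    /\ (forall u, (exists x, f x = u) <-> exists x, f' x = u).
Proof.
move=> kerf fs0 si1.
(* [J] includes the row vectors that vanish at [i], [T] clears the [i]-th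
   coordinate by subtracting a multiple of [s], and [Q] is [T] followed by
   dropping that coordinate. *)
pose J : 'M[R]_(n, n.+1) := row' i 1%:M.
pose T : 'M[R]_n.+1 := 1%:M - delta_mx i 0 *m s.
pose Q : 'M[R]_(n.+1, n) := col' i T.
have TE a b : T a b = (a == b)%:R - (a == i)%:R * s 0 b.
  by rewrite !mxE big_ord1 !mxE eqxx andbT.
have QJ : Q *m J = T.
  apply/matrixP=> a b; rewrite mxE.
  have [j -> | ->] := unliftP i b; last first.
    rewrite big1 => [|j _]; last first.
      by rewrite [J _ _]mxE [1%:M _ _]mxE eq_sym (negPf (neq_lift _ _)) mulr0.
    by rewrite TE si1 mulr1 subrr.
  rewrite (bigD1 j) //= big1 => [|l lj]; rewrite ?addr0.
    by rewrite [Q _ _]mxE [J _ _]mxE [1%:M _ _]mxE eqxx mulr1.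
  by rewrite [J _ _]mxE [1%:M _ _]mxE (inj_eq lift_inj) (negPf lj) mulr0.
have JQ : J *m Q = 1%:M.
  apply/matrixP=> a b; rewrite mxE.
  rewrite (bigD1 (lift i a)) //= big1 => [|l lj]; rewrite ?addr0.
    rewrite [J _ _]mxE [1%:M _ _]mxE eqxx mul1r [Q _ _]mxE TE.
    rewrite (inj_eq lift_inj) [_ == i]eq_sym (negPf (neq_lift _ _)) mul0r subr0.
    by rewrite mxE.
  by rewrite [J _ _]mxE [1%:M _ _]mxE eq_sym (negPf lj) mul0r.
have fT x : f (x *m T) = f x.
  rewrite mulmxBr mulmx1 mulmxA [x *m _]mx11_scalar mul_scalar_mx.
  by rewrite linearB linearZ fs0 /= scaler0 subr0.
pose f' : {linear 'rV[R]_n -> U} := f \o mulmxr J.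
exists f', (B *m Q); split=> [x|u].
  split=> [/kerf[y xE]|[y ->]].
    by exists y; rewrite mulmxA -xE -mulmxA JQ mulmx1.
  by rewrite /f' /= -!mulmxA QJ mulmxA fT; apply/kerf; exists y.
split=> -[x <-]; last by exists (x *m J).
by exists (x *m Q); rewrite /f' /= -mulmxA QJ fT.
Qed.

(** Choosing bases turns the abstract middle of a presentation into the form
that the induction needs: generators given by a map from row vectors, and
relations given by the rows of a matrix. *)
Lemma fg_free_matrix_kernel (F1 F2 U : lmodType R)
    (g : {linear F1 -> U}) (h : {linear F2 -> F1}) :
    fg_free F1 -> fg_free F2 -> exact_at h g ->
  exists (n k : nat) (f : {linear 'rV[R]_n -> U}) (B : 'M[R]_(k, n)),
    (forall x, f x = 0 <-> exists y, x = y *m B)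
    /\ (forall u, (exists x, g x = u) <-> exists x, f x = u).
Proof.
move=> [n [b1 [c1 b1K c1K]]] [k [b2 [c2 b2K c2K]]] hg.
pose B := \matrix_(i < k) c1 (h (b2 (delta_mx 0 i))).
have BE y : b1 (y *m B) = h (b2 y).
  rewrite mulmx_sum_row linear_sum -[RHS]/((h \o b2) y) linear_row_delta /=.
  by apply: eq_bigr => i _; rewrite linearZ rowK c1K.
exists n, k, (g \o b1), B; split=> [x|u] /=.
  split=> [/hg[z zE]|[y ->]]; last by rewrite BE; apply/hg; exists (b2 y).
  by exists (c2 z); apply: (can_inj b1K); rewrite BE c2K.
split=> -[x <-]; last by exists (b1 x).
by exists (c1 x); rewrite c1K.
Qed.

Lemma proj_dim_le1_of_free_syzygy (M F0 : lmodType R) (n : nat)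
    (e : {linear F0 -> M}) (f : {linear 'rV[R]_n -> F0}) :
    fg_free F0 -> surjective e -> exact_at f e -> injective f ->
  proj_dim_le 1 M.
Proof.
move=> F0free e_surj fe f_inj.
pose P (i : nat) : lmodType R :=
  match i with 0 => F0 | 1 => 'rV[R]_n | _ => 'rV[R]_0 end.
pose dP (i : nat) : {linear P i.+1 -> P i} :=
  match i with 0 => f | _ => \0 end.
exists P, dP, e; split=> [i|i lt1i x|m].
- apply: fg_free_projective.
  by case: i => [|[|i]] //; exact: fg_free_rV.
- by case: i lt1i x => [|[|i]] // _ x; exact: (thinmx0 (x : 'rV[R]_0)).
split=> // -[|i] _ y /=; last first.
  by split=> // _; exists 0; rewrite [y](thinmx0 (y : 'rV[R]_0)).
split=> [y0|[x <-]]; last exact: linear0.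
by exists 0; apply: f_inj; rewrite y0 !linear0.
Qed.

End FreeModules.

(** * Syzygies over a semi-valuation ring *)

Section SemiValuationRings.
Local Open Scope ring_scope.
Local Open Scope quotient_scope.
Variables (A : comNzRingType) (d : Order.disp_t) (G : orderedAbGroupType d).
Variable v : valuation A G.
Hypothesis hA : semi_valuation_ring v.

Lemma regular_outside_support (x y : A) :
  x \notin val_support v -> x * y = 0 -> y = 0.
Proof.
move=> xNp xy0; apply/eqP; apply: contraNT xNp => y0.
by apply: (svr_zero_divisor hA); exists y.
Qed.

Lemma support_divisible (x t : A) :
  x \in val_support v -> t \notin val_support v -> exists z, x = t * z.
Proof.
by rewrite !inE => /eqP vx /eqP vt; apply: (svr_dvd hA); rewrite ?vx.
Qed.

(** Since the value of [r 0 j] is nonzero, so is the largest value of an entry;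
the entry attaining it divides all the others, and the quotients form [s]. *)
Lemma row_primitive_part (n : nat) (r : 'rV[A]_n) (j : 'I_n) :
    r 0 j \notin val_support v ->
  exists i s, [/\ r 0 i \notin val_support v, r = r 0 i *: s & s 0 i = 1].
Proof.
move=> rj; pose w i := v (r 0 i); pose ge := [rel a b : option G | vle b a].
have [||||i _ maxi] := @extremumP _ _ ge j xpredT w.
- exact: vle_refl.
- by move=> b a c /= ab bc; exact: vle_trans bc ab.
- by move=> a b; exact: vle_total.
- by [].
have ri : r 0 i \notin val_support v.
  move: rj (maxi j isT); rewrite !inE /= /w.
  by case: (v (r 0 j)) => //= a _; case: (v _).
have rdvd l : exists z, r 0 l = r 0 i * z.
  by apply: (svr_dvd hA); [exact: (maxi l) | move/eqP; exact/negP].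
have [z zE] := fin_all_exists rdvd.
exists i, (\row_l z l); split=> //.
  by apply/rowP=> l; rewrite !mxE.
rewrite mxE; apply/eqP; rewrite -subr_eq0; apply/eqP.
by apply: (regular_outside_support ri); rewrite mulrBr mulr1 -zE subrr.
Qed.

Hypothesis hv : nontrivial_valuation v.

(** Nakayama's argument, run for an arbitrary [t] outside the support: were
[B] nonzero, it would make every such [t] invertible in the residue ring. *)
Lemma relations_in_support_eq0 (k n : nat) (U : lmodType A)
    (f : {linear 'rV[A]_n -> U}) (B : 'M[A]_(k, n)) :
    (forall a u, a \notin val_support v -> a *: u = 0 :> U -> u = 0) ->
    (forall x, f x = 0 <-> exists y, x = y *m B) ->
    (forall i j, B i j \in val_support v) ->
  B = 0.
Proof.
move=> Ureg kerf Bp; apply/eqP/negPn/negP=> B0; apply: hv => x x0.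
pose t := repr x; have xE : x = \pi_(residue_ring v) t by rewrite reprK.
have tNp : t \notin val_support v.
  apply: contra x0 => tp; rewrite xE -(rmorph0 \pi_(residue_ring v)).
  by rewrite -Quotient.idealrBE subr0.
have Bdvd i j : exists z, B i j = t * z by exact: support_divisible.
have [Z ZE] := fin_all_exists (fun i => fin_all_exists (Bdvd i)).
(* [t] times the vector [Z i] is a relation, and [t] acts injectively on [U],
   so [Z i] is a relation itself. *)
have Zker i : exists c, \row_j Z i j = c *m B.
  apply/kerf; apply: Ureg tNp _; rewrite -linearZ.
  have -> : t *: \row_j Z i j = row i B by apply/rowP=> j; rewrite !mxE ZE.
  by apply/kerf; exists (delta_mx 0 i); rewrite rowE.
have [C CE] := fin_all_exists Zker.
have BE : B = t *: (\matrix_i C i *m B).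
  apply/row_matrixP=> i; rewrite linearZ /= row_mul rowK -CE.
  by apply/rowP=> j; rewrite !mxE ZE.
have [c cB0] := mul_det_one_sub BE.
have tc : 1 - t * c \in val_support v.
  apply: contraNT B0 => tcNp; apply/eqP/matrixP=> i j; rewrite [RHS]mxE.
  apply: (regular_outside_support tcNp).
  by move/matrixP: cB0 => /(_ i j); rewrite !mxE.
exists (\pi_(residue_ring v) c).
rewrite xE -rmorphM -(rmorph1 \pi_(residue_ring v)).
by apply/esym/eqP; rewrite -Quotient.idealrBE.
Qed.

(** The image of [f] is a finitely presented module on which the elements
outside the support act injectively; it is free because one can remove
generators until no relation has a coefficient outside the support, and then
there is no relation left. *)
Lemma fp_torsionfree_free (n k : nat) (U : lmodType A)
    (f : {linear 'rV[A]_n -> U}) (B : 'M[A]_(k, n)) :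
    (forall a u, a \notin val_support v -> a *: u = 0 :> U -> u = 0) ->
    (forall x, f x = 0 <-> exists y, x = y *m B) ->
  exists (m : nat) (g : {linear 'rV[A]_m -> U}),
    injective g /\ (forall u, (exists x, f x = u) <-> exists x, g x = u).
Proof.
move=> Ureg; elim: n f B => [|n IHn] f B kerf.
  by exists 0%N, f; split=> // x y _; rewrite !thinmx0.
case: (boolP [forall i, forall j, B i j \in val_support v]) => [Bp|].
  have B0 : B = 0.
    apply: relations_in_support_eq0 Ureg kerf _ => i j.
    exact: (forallP (forallP Bp i) j).
  exists n.+1, f; split=> // x y fxy; apply/eqP; rewrite -subr_eq0; apply/eqP.
  have /kerf[z ->] : f (x - y) = 0 by rewrite linearB fxy subrr.
  by rewrite B0 mulmx0.
rewrite negb_forall => /existsP[i]; rewrite negb_forall => /existsP[j Bij].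
have rij : row i B 0 j \notin val_support v by rewrite mxE.
have [l [s [rl rE sl]]] := row_primitive_part rij.
have fs0 : f s = 0.
  apply: Ureg rl _; rewrite -linearZ -rE.
  by apply/kerf; exists (delta_mx 0 i); rewrite rowE.
have [f' [B' [kerf' imf']]] := eliminate_generator kerf fs0 sl.
have [m [g [g_inj img]]] := IHn f' B' kerf'.
by exists m, g; split=> // u; apply: iff_trans (imf' u) (img u).
Qed.

Lemma finitely_2_presented_proj_dim_le1 (M : lmodType A) :
  finitely_presented 2 M -> proj_dim_le 1 M.
Proof.
move=> [F [dF [e [Ffree [e_surj exF0 exF]]]]].
have F0reg a (u : F 0%N) : a \notin val_support v -> a *: u = 0 -> u = 0.
  move=> aNp; apply: fg_free_regular (Ffree 0%N isT) _ => b.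
  exact: regular_outside_support.
have [n [k [f [B [kerf imf]]]]] :=
  fg_free_matrix_kernel (Ffree 1%N isT) (Ffree 2%N isT) (exF 0 isT).
have [m [g [g_inj img]]] := fp_torsionfree_free F0reg kerf.
apply: (proj_dim_le1_of_free_syzygy (Ffree 0%N isT) e_surj _ g_inj) => y.
exact: iff_trans (exF0 isT y) (iff_trans (imf y) (img y)).
Qed.

End SemiValuationRings.

Theorem lemma3p7 (A : comNzRingType) (d : Order.disp_t)
    (G : orderedAbGroupType d) (v : valuation A G)
    (hA : semi_valuation_ring v) (hv : nontrivial_valuation v) :
  (forall M : lmodType A, finitely_presented 2 M -> proj_dim_le 1 M)
  /\ n_regular 2 A.
Proof.
have pd1 (M : lmodType A) : finitely_presented 2 M -> proj_dim_le 1 M.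
  exact: finitely_2_presented_proj_dim_le1 hA hv M.
by split=> // M /pd1; exists 1%N.
Qed.
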